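(* If $G$ is a connected graph having $n\geq 3$ vertices with minimum degree $\delta\geq 2$, then \[\frac{\sqrt{2(n-2)}}{n-1}\,GA(G)\leq ABC(G)\leq\frac{n+1}{4\sqrt{n-1}}\,GA(G),\] with left equality if and only if $G\cong K_{n}$ and right equality if and only if $G\cong C_{3}$.
   Context: Graphs are finite and simple, with vertex set $V(G)=\{v_1,\dots,v_n\}$ and edge set $E(G)$. $d_i$ is the degree of the vertex $v_i$, and $ij$ denotes the edge joining $v_i$ and $v_j$. The atom-bond connectivity index is $ABC(G)=\sum_{ij\in E(G)}\sqrt{\frac{d_i+d_j-2}{d_id_j}}$ and the first geometric-arithmetic index is $GA(G)=\sum_{ij\in E(G)}\frac{\sqrt{d_id_j}}{\frac12(d_i+d_j)}$. $K_k$ and $C_k$ denote the complete graph and the cycle on $k$ vertices. *)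

(* Defs.v *)
From mathcomp Require Import all_boot all_order all_algebra.
From mathcomp Require Import reals.

Set Implicit Arguments.
Unset Strict Implicit.
Unset Printing Implicit Defensive.

Import Order.TTheory GRing.Theory Num.Theory.

Record sgraph (n : nat) := SGraph {
  adj :> rel 'I_n;
  adj_sym : symmetric adj;
  adj_irr : irreflexive adj
}.

Definition giso (n m : nat) (G : sgraph n) (H : sgraph m) : Prop :=
  exists2 f : 'I_n -> 'I_m, bijective f & forall i j, H (f i) (f j) = G i j.

Definition gconnected (n : nat) (G : sgraph n) : Prop :=
  0 < n /\ forall i j : 'I_n, connect G i j.

Definition deg (n : nat) (G : sgraph n) (i : 'I_n) : nat := #|[set j | G i j]|.

(* The default value n exceeds every degree, so for 0 < n this is the true
   minimum. *)
Definition min_degree (n : nat) (G : sgraph n) : nat :=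
  \big[minn/n]_(i < n) deg G i.

Lemma complete_sym k : symmetric (fun i j : 'I_k => i != j).
Proof. by move=> i j; rewrite eq_sym. Qed.

Lemma complete_irr k : irreflexive (fun i j : 'I_k => i != j).
Proof. by move=> i; rewrite eqxx. Qed.

Definition complete_graph (k : nat) : sgraph k :=
  SGraph (@complete_sym k) (@complete_irr k).

(* The condition i != j only matters for k = 1, where it removes the loop. *)
Definition cycle_adj (k : nat) : rel 'I_k := fun i j =>
  (i != j) && ((j == i.+1 %% k :> nat) || (i == j.+1 %% k :> nat)).

Lemma cycle_sym k : symmetric (@cycle_adj k).
Proof. by move=> i j; rewrite /cycle_adj eq_sym orbC. Qed.

Lemma cycle_irr k : irreflexive (@cycle_adj k).
Proof. by move=> i; rewrite /cycle_adj eqxx. Qed.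

Definition cycle_graph (k : nat) : sgraph k :=
  SGraph (@cycle_sym k) (@cycle_irr k).

Local Open Scope ring_scope.

(* Each edge ij is counted once, through its orientation with i < j. *)
Definition edge_sum (R : rcfType) (n : nat) (G : sgraph n)
    (w : R -> R -> R) : R :=
  \sum_(i < n) \sum_(j < n | (i < j)%N && G i j) w (deg G i)%:R (deg G j)%:R.

Definition ABC (R : rcfType) (n : nat) (G : sgraph n) : R :=
  edge_sum G (fun x y => Num.sqrt ((x + y - 2) / (x * y))).

Definition GA (R : rcfType) (n : nat) (G : sgraph n) : R :=
  edge_sum G (fun x y => Num.sqrt (x * y) / (1 / 2 * (x + y))).

(* Main.v *)
Require Import Defs.
From mathcomp Require Import all_boot all_order all_algebra.
From mathcomp Require Import reals.
From mathcomp Require Import ring lra.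
Set Implicit Arguments.
Unset Strict Implicit.
Unset Printing Implicit Defensive.

Import Order.TTheory GRing.Theory Num.Theory.
Local Open Scope ring_scope.

(** Both bounds hold edge by edge, and this is what fixes the cases of
equality.  Write m = n - 1.  Every degree lies in [2, m], and an edge whose
endpoints have degrees x and y contributes to ABC exactly
  f(x, y) = (x + y) sqrt(x + y - 2) / (2 x y)
times its contribution to GA.  So it suffices to find the extreme values of f
on the square [2, m]^2, together with the points where they are reached.

Minimum.  Put s = x + y.  Since x y <= s^2 / 4, we have
f^2 >= 4 (s - 2) / s^2, which decreases in s for s >= 4; hence the minimum is
reached at s = 2 m only, that is at x = y = m ([lower_weight]).

Maximum.  On 2 <= x <= y the value of f decreases in x, so
f(x, y) <= f(2, y) = (y + 2) / (4 sqrt y), which increases in y; hence the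
maximum is reached only at (2, m) and, by symmetry, at (m, 2)
([upper_weight]).

The inequalities are carried with their equality condition, as
[_ <= _ ?= iff _], so that summing over the edges ([edge_sum_leif]) shows at
once that equality of the sums means equality on each edge.  What remains is
combinatorial.  If both ends of each edge have degree n - 1, so has every
vertex, since none is isolated, and the graph is complete
([all_edges_full], [giso_completeP]).  If each edge joins a vertex of degree 2
to one of degree n - 1, then n = 3: a vertex v of degree n - 1 is adjacent to
all the others, so for n > 3 these have degree 2, and the second neighbour of
one of them gives an edge with two ends of degree 2
([all_edges_two_full]). *)

(** * Degrees, complete graphs and the triangle *)

Lemma deg_le (n : nat) (G : sgraph n) i : (deg G i <= n.-1)%N.
Proof.
have <- : #|[set~ i]| = n.-1 by rewrite cardsC1 card_ord.
apply/subset_leq_card/subsetP=> j; rewrite !inE => Gij.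
by apply: contraTneq Gij => ->; rewrite adj_irr.
Qed.

(** The neighbourhood of i is contained in the complement of i, which has n - 1
elements; equal cardinals make the two sets equal. *)
Lemma deg_eq_full (n : nat) (G : sgraph n) i j :
  deg G i = n.-1 -> i != j -> G i j.
Proof.
move=> di ij.
have sub : [set k | G i k] \subset [set~ i].
  by apply/subsetP=> k; rewrite !inE; apply: contraTneq => ->; rewrite adj_irr.
have /eqP : #|[set k | G i k]| == #|[set~ i]| by rewrite cardsC1 card_ord -di.
move=> /subset_cardP/(_ sub j); rewrite !inE => ->.
by rewrite eq_sym.
Qed.

Lemma complete_deg (n : nat) i : deg (complete_graph n) i = n.-1.
Proof.
rewrite -[in RHS](card_ord n) -(cardsC1 i).
by apply: eq_card => j; rewrite !inE eq_sym.
Qed.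

Lemma giso_deg (n m : nat) (G : sgraph n) (H : sgraph m) (f : 'I_n -> 'I_m) :
  bijective f -> (forall i j, H (f i) (f j) = G i j) ->
  forall i, deg H (f i) = deg G i.
Proof.
move=> [g fK gK] Hf i; rewrite /deg -(card_imset _ (can_inj fK)).
apply: eq_card => j; rewrite inE; apply/idP/imsetP=> [Hj|[k]].
  by exists (g j); rewrite ?gK // inE -Hf gK.
by rewrite inE -Hf => Hk ->.
Qed.

Lemma min_degree_le (n : nat) (G : sgraph n) i : (min_degree G <= deg G i)%N.
Proof. by rewrite /min_degree -minEnat -leEnat bigmin_le. Qed.

(** The identity is an isomorphism as soon as all degrees are maximal, so the
isomorphism class of the complete graph is read off from the degrees. *)
Lemma giso_completeP (n : nat) (G : sgraph n) :
  giso G (complete_graph n) <-> forall i, deg G i = n.-1.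
Proof.
split=> [[f bf Hf] i|full].
  by rewrite -(giso_deg bf Hf) complete_deg.
exists id; first by exists id.
move=> i j; rewrite /=; apply/idP/idP; first exact: deg_eq_full (full i).
by apply: contraTneq => ->; rewrite adj_irr.
Qed.

Lemma cycle3_adj (i j : 'I_3) : cycle_graph 3 i j = complete_graph 3 i j.
Proof. by case: i j => [[|[|[|?]]] ?] [[|[|[|?]]] ?]. Qed.

(** The triangle is the complete graph on three vertices, so this reduces to
the characterization of complete graphs by their degrees. *)
Lemma giso_cycle3P (n : nat) (G : sgraph n) :
  giso G (cycle_graph 3) <-> n = 3 /\ forall i, deg G i = n.-1.
Proof.
split=> [[f bf Hf]|[n3]]; last first.
  subst n; move=> /giso_completeP[f bf Hf].
  by exists f => // i j; rewrite cycle3_adj Hf.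
have n3 : n = 3 by have := bij_eq_card bf; rewrite !card_ord.
split=> //; subst n.
by apply/giso_completeP; exists f => // i j; rewrite -cycle3_adj Hf.
Qed.

(** * Edge conditions in the cases of equality *)

(** Positive minimum degree puts every vertex on some edge, which turns a
condition on edges into a condition on vertices. *)
Lemma all_edges_full (n : nat) (G : sgraph n) : (0 < min_degree G)%N ->
  [forall i, forall j, G i j ==> (deg G i == n.-1) && (deg G j == n.-1)]
    <-> forall i, deg G i = n.-1.
Proof.
move=> dG; split=> [/forallP h i|full].
  have := leq_trans dG (min_degree_le G i).
  move=> /card_gt0P[j]; rewrite inE => Gij.
  by have /forallP/(_ j) := h i; rewrite Gij => /andP[/eqP].
by apply/forallP=> i; apply/forallP=> j; rewrite !full eqxx implybT.
Qed.

(** For n > 3 the edge condition is contradictory: take v of degree n - 1, a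
neighbour u of v, and a neighbour w of u other than v.  As v is adjacent to
everything, u and w both have degree 2 (their edges to v cannot be otherwise,
because n - 1 <> 2), so the edge uw violates the condition. *)
Lemma all_edges_two_full (n : nat) (G : sgraph n) :
    (3 <= n)%N -> (2 <= min_degree G)%N ->
  [forall i, forall j, G i j ==>
     ((deg G i == 2) && (deg G j == n.-1))
     || ((deg G i == n.-1) && (deg G j == 2))]
    <-> n = 3 /\ forall i, deg G i = n.-1.
Proof.
move=> n3 dG; split=> [h|[n3' full]]; last first.
  apply/forallP=> i; apply/forallP=> j; rewrite !full.
  by subst n; rewrite implybT.
have {}h i j : G i j -> [\/ deg G i = 2 /\ deg G j = n.-1
                          | deg G i = n.-1 /\ deg G j = 2].
  move=> Gij; have /forallP/(_ j) := forallP h i; rewrite Gij /=.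
  by case/orP => /andP[/eqP-> /eqP->]; [left|right].
have deg_ge2 i : (2 <= deg G i)%N := leq_trans dG (min_degree_le G i).
have nb i : exists j, G i j.
  have /card_gt0P[j] : (0 < deg G i)%N := ltnW (deg_ge2 i).
  by rewrite inE; exists j.
case: (eqVneq n 3) => [n3'|n_neq3].
  split=> // i; apply/eqP; rewrite eqn_leq deg_le /=.
  by apply: leq_trans (deg_ge2 i); rewrite n3'.
have full_neq2 : n.-1 <> 2.
  by move=> n1; case/eqP: n_neq3; rewrite -(prednK (ltnW (ltnW n3))) n1.
have [v dv] : exists v, deg G v = n.-1.
  have [j Gij] := nb (Ordinal (ltnW (ltnW n3))).
  by case: (h _ _ Gij) => -[]; eauto.
have d2 w : w != v -> deg G w = 2.
  rewrite eq_sym => /(deg_eq_full dv)/h[[dv2]|[]//].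
  by case: full_neq2; rewrite -dv.
have [u Gvu] := nb v.
have uv : u != v by apply: contraTneq Gvu => ->; rewrite adj_irr.
have /card_gt1P[a [b [au bu ab]]] := deg_ge2 u.
have [w [wv Guw]] : exists w, w != v /\ G u w.
  rewrite !inE in au bu; case: (eqVneq a v) => [av|]; last by exists a.
  by exists b; rewrite -av eq_sym.
by case: full_neq2; case: (h _ _ Guw); rewrite !d2 // => -[].
Qed.

(** * Extreme values of the quotient of the two edge weights *)

Section EdgeWeights.
Variable R : rcfType.
Implicit Types k m x y : R.

Definition abc_weight x y : R := Num.sqrt ((x + y - 2) / (x * y)).
Definition ga_weight x y : R := Num.sqrt (x * y) / (1 / 2 * (x + y)).

(** Putting a scaled weight under a single square root lets the comparison of
weights be made between rational functions; the next two lemmas do the same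
for the constants of the theorem, with m = n - 1. *)
Lemma scaled_ga_weight k x y : 0 <= k -> 0 < x -> 0 < y ->
  Num.sqrt k * ga_weight x y = Num.sqrt (4 * k * (x * y) / (x + y) ^+ 2).
Proof.
move=> k0 x0 y0; have s0 : 0 < x + y by lra.
have -> : 4 * k * (x * y) / (x + y) ^+ 2
    = k * ((x * y) * ((1 / 2 * (x + y))^-1) ^+ 2) by field; lra.
rewrite [RHS]sqrtrM // [in RHS]sqrtrM; last by rewrite mulr_ge0 ?ltW.
by rewrite sqrtr_sqr ger0_norm // invr_ge0; lra.
Qed.

Lemma lower_constE m : 1 <= m ->
  Num.sqrt (2 * (m - 1)) / m = Num.sqrt (2 * (m - 1) / m ^+ 2).
Proof.
move=> m1; rewrite [in RHS]sqrtrM; last by lra.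
by rewrite -exprVn sqrtr_sqr ger0_norm // invr_ge0; lra.
Qed.

Lemma upper_constE m : 0 < m ->
  (m + 2) / (4 * Num.sqrt m) = Num.sqrt ((m + 2) ^+ 2 / (16 * m)).
Proof.
move=> m0; have r0 : 0 < Num.sqrt m by rewrite sqrtr_gt0.
have -> : (m + 2) ^+ 2 / (16 * m) = ((m + 2) / (4 * Num.sqrt m)) ^+ 2.
  by rewrite expr_div_n exprMn sqr_sqrtr ?ltW //; field; lra.
by rewrite sqrtr_sqr ger0_norm // divr_ge0 //; lra.
Qed.

(** This is f(m, m) < f(x, y) after squaring and clearing denominators.  With
s = x + y, it combines the arithmetic-geometric mean inequality
16 (x y)^2 <= s^4 with the strict decrease of (s - 2) / s^2 for s >= 4,
evaluated at s < 2 m. *)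
Lemma lower_poly m x y : 2 <= x <= m -> 2 <= y <= m -> x + y < 2 * m ->
  8 * (m - 1) * (x * y) ^+ 2 < (x + y - 2) * m ^+ 2 * (x + y) ^+ 2.
Proof.
move=> hx hy sm; set s := x + y in sm *.
have s4 : 4 <= s by rewrite /s; lra.
have amgm : 16 * (x * y) ^+ 2 <= s ^+ 2 * s ^+ 2.
  rewrite -subr_ge0.
  have -> : s ^+ 2 * s ^+ 2 - 16 * (x * y) ^+ 2
     = (x - y) ^+ 2 * (s ^+ 2 + 4 * (x * y)) by rewrite /s; ring.
  by rewrite mulr_ge0 ?sqr_ge0 // addr_ge0 ?sqr_ge0 // !mulr_ge0 //; lra.
have mono : (m - 1) * s ^+ 2 < 2 * (s - 2) * m ^+ 2.
  rewrite -subr_gt0.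
  have -> : 2 * (s - 2) * m ^+ 2 - (m - 1) * s ^+ 2
     = (2 * m - s) * ((m - 2) * (s - 2) + (s - 4)) by ring.
  rewrite mulr_gt0 ?subr_gt0 //.
  have : 0 < (m - 2) * (s - 2) by apply: mulr_gt0; lra.
  lra.
have h1 : (m - 1) * (16 * (x * y) ^+ 2) <= (m - 1) * (s ^+ 2 * s ^+ 2).
  by rewrite ler_wpM2l //; lra.
have h2 : (m - 1) * s ^+ 2 * s ^+ 2 < 2 * (s - 2) * m ^+ 2 * s ^+ 2.
  by rewrite ltr_pM2r // exprn_gt0 //; lra.
lra.
Qed.

(** This is f(x, y) <= f(2, y) after squaring and clearing denominators.  The
difference of the two sides vanishes at x = 2, and expanding it around the
corner x = y = 2 in the nonnegative quantities x - 2 and y - x gives only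
nonnegative coefficients. *)
Lemma upper_poly_small x y : 2 <= x <= y ->
  4 * (x + y - 2) * (x + y) ^+ 2 <= x ^+ 2 * (2 + y) ^+ 2 * y
    ?= iff (x == 2).
Proof.
move=> /andP[x2 xy]; apply/leifP; case: eqP => [->|/eqP x_neq2].
  by apply/eqP; ring.
have : 0 < x - 2 by rewrite subr_gt0 lt_neqAle eq_sym x_neq2.
have : 0 <= y - x by lra.
set a := x - 2; set b := y - x => b0 a0; rewrite -subr_gt0.
(* The term 40 * a is kept apart: it alone gives strict positivity. *)
have -> : x ^+ 2 * (2 + y) ^+ 2 * y - 4 * (x + y - 2) * (x + y) ^+ 2
  = a * (40 * a + (48 * b + 44 * a ^+ 2 + 76 * a * b + 28 * b ^+ 2
     + 14 * a ^+ 3 + 32 * a ^+ 2 * b + 22 * a * b ^+ 2 + 4 * b ^+ 3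
     + a ^+ 4 + 3 * a ^+ 3 * b + 3 * a ^+ 2 * b ^+ 2 + a * b ^+ 3)).
  by rewrite /a /b; ring.
have a0' := ltW a0.
by rewrite mulr_gt0 // ltr_wpDr ?mulr_gt0 // !addr_ge0 // ?mulr_ge0 ?exprn_ge0.
Qed.

(** This is f(2, y) <= f(2, m) after squaring and clearing denominators, the
monotonicity of (2 + y)^2 / y for y >= 2. *)
Lemma upper_poly_large m y : 2 <= y <= m ->
  (2 + y) ^+ 2 * m <= (2 + m) ^+ 2 * y ?= iff (y == m).
Proof.
move=> /andP[y2 ym]; apply/leifP; case: eqP => [->//|/eqP y_neqm].
have {}ym : y < m by rewrite lt_neqAle y_neqm.
rewrite -subr_gt0.
have -> : (2 + m) ^+ 2 * y - (2 + y) ^+ 2 * m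
  = (m - y) * (m * (y - 2) + 2 * (m - 2)) by ring.
rewrite mulr_gt0 ?subr_gt0 //.
have : 0 <= m * (y - 2) by apply: mulr_ge0; lra.
lra.
Qed.

Lemma upper_poly m x y : 2 <= x <= y -> y <= m ->
  4 * (x + y - 2) * (x + y) ^+ 2 * m <= (m + 2) ^+ 2 * (x * y) ^+ 2
    ?= iff (x == 2) && (y == m).
Proof.
move=> hxy ym; have [x2 xy] := andP hxy.
have x0 : 0 < x ^+ 2 * y by rewrite mulr_gt0 ?exprn_gt0 //; lra.
have m0 : 0 < m by lra.
have h1 : 4 * (x + y - 2) * (x + y) ^+ 2 * m
    <= x ^+ 2 * (2 + y) ^+ 2 * y * m ?= iff (x == 2).
  by rewrite (mono_leif (ler_pM2r m0)); exact: upper_poly_small.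
apply: leif_trans h1 _.
have -> : x ^+ 2 * (2 + y) ^+ 2 * y * m
  = x ^+ 2 * y * ((2 + y) ^+ 2 * m) by ring.
have -> : (m + 2) ^+ 2 * (x * y) ^+ 2
  = x ^+ 2 * y * ((2 + m) ^+ 2 * y) by ring.
rewrite (mono_leif (ler_pM2l x0)); apply: upper_poly_large; lra.
Qed.

Lemma leif_sqrt (a b : R) (C : bool) : 0 <= a -> 0 <= b -> a <= b ?= iff C ->
  Num.sqrt a <= Num.sqrt b ?= iff C.
Proof. by move=> a0 b0 ab; split; rewrite ?ler_wsqrtr ?ab // eqr_sqrt ?ab. Qed.

Lemma leif_frac (a b c d : R) (C : bool) : 0 < b -> 0 < d ->
  a * d <= c * b ?= iff C -> a / b <= c / d ?= iff C.
Proof.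
move=> b0 d0 [h1 h2]; split; first by rewrite ler_pdivrMr // mulrAC ler_pdivlMr.
by rewrite -h2 eqr_div // gt_eqF.
Qed.

Lemma lower_weight m x y : 2 <= x <= m -> 2 <= y <= m ->
  Num.sqrt (2 * (m - 1)) / m * ga_weight x y <= abc_weight x y
    ?= iff (x == m) && (y == m).
Proof.
move=> hx hy.
have k0 : 0 <= 2 * (m - 1) / m ^+ 2 by rewrite divr_ge0 ?sqr_ge0 //; lra.
have p0 : 0 < x * y by rewrite mulr_gt0 //; lra.
have m0 : 0 < m ^+ 2 by rewrite exprn_gt0 //; lra.
have s0 : 0 < (x + y) ^+ 2 by rewrite exprn_gt0 //; lra.
rewrite lower_constE ?scaled_ga_weight //; try lra.
apply: leif_sqrt.
- by rewrite divr_ge0 ?sqr_ge0 // mulr_ge0 ?(ltW p0) // mulr_ge0.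
- by rewrite divr_ge0 ?(ltW p0) //; lra.
have -> : 4 * (2 * (m - 1) / m ^+ 2) * (x * y) / (x + y) ^+ 2
    = 8 * (m - 1) * (x * y) / (m ^+ 2 * (x + y) ^+ 2) by field; lra.
apply: leif_frac => //; first exact: mulr_gt0.
have -> : 8 * (m - 1) * (x * y) * (x * y) = 8 * (m - 1) * (x * y) ^+ 2 by ring.
rewrite mulrA; apply/leifP; case: ifP => [/andP[/eqP-> /eqP->]|].
  by apply/eqP; ring.
move=> /negbT; rewrite negb_and !neq_lt => ne; apply: lower_poly => //.
by case/orP: ne => /orP[]; lra.
Qed.

Lemma abc_weightC x y : abc_weight x y = abc_weight y x.
Proof. by rewrite /abc_weight (addrC x) (mulrC x). Qed.

Lemma ga_weightC x y : ga_weight x y = ga_weight y x.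
Proof. by rewrite /ga_weight (addrC x) (mulrC x). Qed.

(** The assumption x <= y, under which f decreases in x, costs nothing by
symmetry; it also explains why the maximum is reached at two points. *)
Lemma upper_weight m x y : 2 <= x <= m -> 2 <= y <= m ->
  abc_weight x y <= (m + 2) / (4 * Num.sqrt m) * ga_weight x y
    ?= iff ((x == 2) && (y == m)) || ((x == m) && (y == 2)).
Proof.
wlog xy : x y / x <= y.
  move=> sym hx hy; have [xy|/ltW yx] := leP x y; first exact: sym.
  rewrite abc_weightC ga_weightC orbC [X in X || _]andbC [X in _ || X]andbC.
  exact: sym.
move=> hx hy.
have k0 : 0 <= (m + 2) ^+ 2 / (16 * m) by rewrite divr_ge0 ?sqr_ge0 //; lra.
have p0 : 0 < x * y by rewrite mulr_gt0 //; lra.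
have m0 : 0 < m by lra.
have s0 : 0 < (x + y) ^+ 2 by rewrite exprn_gt0 //; lra.
have -> : (x == 2) && (y == m) || (x == m) && (y == 2) = (x == 2) && (y == m).
  apply/orb_idr=> /andP[/eqP xm /eqP y2].
  by apply/andP; split; apply/eqP; lra.
rewrite upper_constE ?scaled_ga_weight //; try lra.
apply: leif_sqrt.
- by rewrite divr_ge0 ?(ltW p0) //; lra.
- by rewrite divr_ge0 ?sqr_ge0 // mulr_ge0 ?(ltW p0) // mulr_ge0.
have -> : 4 * ((m + 2) ^+ 2 / (16 * m)) * (x * y) / (x + y) ^+ 2
    = (m + 2) ^+ 2 * (x * y) / (4 * (x + y) ^+ 2 * m) by field; lra.
apply: leif_frac => //; first by rewrite mulr_gt0 // mulr_gt0.
rewrite -(mulrA (_ ^+ 2) (x * y)) -expr2.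
have -> : (x + y - 2) * (4 * (x + y) ^+ 2 * m)
    = 4 * (x + y - 2) * (x + y) ^+ 2 * m by ring.
apply: upper_poly; lra.
Qed.

(** * From edges to sums over edges *)

Lemma edge_sumZ (n : nat) (G : sgraph n) (c : R) w :
  c * edge_sum G w = edge_sum G (fun x y => c * w x y).
Proof.
by rewrite /edge_sum mulr_sumr; apply: eq_bigr => i _; rewrite mulr_sumr.
Qed.

(** A sum of termwise inequalities is an equality exactly when every term is.
The sum sees each edge in the orientation i < j only; the symmetry of [C]
extends the condition to both orientations, which is the form in which the
graph-theoretic lemmas use it. *)
Lemma edge_sum_leif (n : nat) (G : sgraph n) (w1 w2 : R -> R -> R)
    (C : nat -> nat -> bool) :
  symmetric C ->
  (forall i j, G i j -> w1 (deg G i)%:R (deg G j)%:R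
     <= w2 (deg G i)%:R (deg G j)%:R ?= iff C (deg G i) (deg G j)) ->
  edge_sum G w1 <= edge_sum G w2
    ?= iff [forall i, forall j, G i j ==> C (deg G i) (deg G j)].
Proof.
move=> Csym w12.
have -> : [forall i, forall j, G i j ==> C (deg G i) (deg G j)]
  = [forall i : 'I_n, forall (j : 'I_n | (i < j)%N && G i j), C (deg G i) (deg G j)].
  apply/forallP/forallP=> h i; apply/forallP=> j; apply/implyP.
    by case/andP=> _; apply/implyP; exact: (forallP (h i) j).
  move=> Gij; have [ij|ji|/val_inj ij] := ssrnat.ltngtP i j.
  - by have /forallP/(_ j) := h i; rewrite ij Gij.
  - by have /forallP/(_ i) := h j; rewrite ji adj_sym Gij Csym.
  - by rewrite ij adj_irr in Gij.
by apply: leif_sum => i _; apply: leif_sum => j /andP[_]; exact: w12.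
Qed.

End EdgeWeights.

Theorem theorem2p8 (R : realType) (n : nat) (G : sgraph n)
    (hn : (3 <= n)%N) (hconn : gconnected G) (hdeg : (2 <= min_degree G)%N) :
  [/\ Num.sqrt (2 * (n%:R - 2)) / (n%:R - 1) * GA R G <= ABC R G,
      ABC R G <= (n%:R + 1) / (4 * Num.sqrt (n%:R - 1)) * GA R G,
      Num.sqrt (2 * (n%:R - 2)) / (n%:R - 1) * GA R G = ABC R G
        <-> giso G (complete_graph n)
    & ABC R G = (n%:R + 1) / (4 * Num.sqrt (n%:R - 1)) * GA R G
        <-> giso G (cycle_graph 3)].
Proof.
have nE : n%:R = n.-1%:R + 1 :> R by rewrite natr1 prednK // (ltn_trans _ hn).
have -> : n%:R - 2 = n.-1%:R - 1 :> R by lra.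
have -> : n%:R + 1 = n.-1%:R + 2 :> R by lra.
have -> : n%:R - 1 = n.-1%:R :> R by lra.
have dR i : (2%:R <= (deg G i)%:R :> R) && ((deg G i)%:R <= n.-1%:R :> R).
  by rewrite !ler_nat deg_le (leq_trans hdeg) ?min_degree_le.
have lower : Num.sqrt (2 * (n.-1%:R - 1)) / n.-1%:R * GA R G <= ABC R G ?= iff
    [forall i, forall j, G i j ==> (deg G i == n.-1) && (deg G j == n.-1)].
  rewrite /GA edge_sumZ.
  apply: (edge_sum_leif (C := fun k l => (k == n.-1) && (l == n.-1)))
    => [k l|i j _]; first by rewrite andbC.
  by rewrite -!(eqr_nat R); exact: lower_weight (dR i) (dR j).
have upper : ABC R G <= (n.-1%:R + 2) / (4 * Num.sqrt n.-1%:R) * GA R G ?= iff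
    [forall i, forall j, G i j ==> ((deg G i == 2) && (deg G j == n.-1))
      || ((deg G i == n.-1) && (deg G j == 2))].
  rewrite /GA edge_sumZ.
  apply: (edge_sum_leif (C := fun k l => (k == 2) && (l == n.-1)
      || (k == n.-1) && (l == 2))) => [k l|i j _].
    by rewrite orbC andbC [X in _ || X]andbC.
  by rewrite -!(eqr_nat R); exact: upper_weight (dR i) (dR j).
split; [by rewrite lower|by rewrite upper| |].
- rewrite giso_completeP -all_edges_full ?(ltnW hdeg) // -(eq_leif lower).
  by split=> /eqP.
- rewrite giso_cycle3P -all_edges_two_full // -(eq_leif upper).
  by split=> /eqP.
Qed.
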